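(* Let $(M,\Sigma,\mu)$ be a $\sigma$-finite measure space and let $(x_t,f_t)_{t\in M}\subseteq X\times X^*$ be a continuous Schauder frame for a separable Banach space $X$. Then $(x_t,f_t)_{t\in M}$ is shrinking if and only if its dual frame $(f_t,x_t)_{t\in M}\subseteq X^*\times X^{**}$ (with $X$ canonically embedded in $X^{**}$) is a continuous Schauder frame for $X^*$.
   Context: Pettis integral: for a $\sigma$-finite measure space $(M,\Sigma,\mu)$ and a separable Banach space $X$, a function $F:M\to X$ is Pettis integrable if for every $E\in\Sigma$ there is $x_E\in X$ with $f(x_E)=\int_E f(F)\,d\mu$ (Lebesgue integral) for all $f\in X^*$; then $\int_E F\,d\mu:=x_E$. Continuous Schauder frame: a measurable map $t\mapsto (x_t,f_t)\in X\times X^*$ on $M$, where $X$ is a separable Banach space, is a continuous Schauder frame of $X$ if for every $x\in X$ the function $t\mapsto f_t(x)x_t$ is Pettis integrable and $x=\int_M f_t(x)x_t\,d\mu(t)$. Directed set: $\mathcal D=\{E\in\Sigma:\mu(E)<\infty \text{ and } \sup_{t\in E}\|f_t\|\|x_t\|<\infty\}$, ordered by inclusion ($E\preceq F$ iff $E\subseteq F$). Tail operator: for $E\in\Sigma$, $T_E:X\to X$ is the bounded operator $T_E(x)=\int_{M\setminus E}f_t(x)x_t\,d\mu(t)$, with adjoint $T_E^*:X^*\to X^*$. Shrinking: the continuous Schauder frame $(x_t,f_t)_{t\in M}$ is shrinking if $\lim_{E\in\mathcal D}\|T_E^*f\|=0$ for all $f\in X^*$. *)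

(* Defs.v *)
From HB Require Import structures.
From mathcomp Require Import all_boot all_order all_algebra.
From mathcomp Require Import all_classical all_reals all_analysis.

Set Implicit Arguments.
Unset Strict Implicit.
Unset Printing Implicit Defensive.

Import Order.TTheory GRing.Theory Num.Theory.
Import numFieldNormedType.Exports.

Local Open Scope classical_set_scope.
Local Open Scope ring_scope.

(** The operator norm of a functional takes values in [\bar R], so that it makes
    sense before boundedness is known and is [+oo] on unbounded functionals. *)
Definition functional_norm (R : realType) (X : normedModType R) (g : X -> R) :
    \bar R :=
  ereal_sup [set `|g x|%:E | x in [set x : X | `|x| <= 1]].

Definition continuous_functional (R : realType) (X : normedModType R) :
    {pred X -> R} :=
  fun g => `[< scalar g /\ continuous g >].

Record topdual (R : realType) (X : normedModType R) := Topdual {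
  topdual_fun :> X -> R ;
  topdual_funP : topdual_fun \in @continuous_functional R X }.

Section topdual_lmodule.
Context {R : realType} {X : normedModType R}.

HB.instance Definition _ := [isSub for @topdual_fun R X].
HB.instance Definition _ := gen_eqMixin (topdual X).
HB.instance Definition _ := gen_choiceMixin (topdual X).

Fact continuous_functional_submod : submod_closed (@continuous_functional R X).
Proof.
split=> [|a f g /asboolP[lf cf] /asboolP[lg cg]]; apply/asboolP; split.
- by move=> k u v; rewrite mulr0 addr0.
- by move=> u; exact: cvg_cst.
- move=> k u v; rewrite -[LHS]/(a * f (k *: u + v) + g (k *: u + v)).
  rewrite lf lg /= -[RHS]/(k * (a * f u + g u) + (a * f v + g v)).
  by rewrite !mulrDr mulrCA addrACA.
- by move=> u; apply: cvgD (cg u); apply: cvgZr; exact: cf.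
Qed.

HB.instance Definition _ := GRing.isSubmodClosed.Build R (X -> R)
  (@continuous_functional R X) continuous_functional_submod.
HB.instance Definition _ :=
  [SubChoice_isSubLmodule of topdual X by <:].

End topdual_lmodule.

Section topdual_normed.
Context {R : realType} {X : normedModType R}.
Implicit Types (f g : topdual X) (x : X).

Lemma topdual_linear f : scalar f.
Proof. by have /asboolP[] := topdual_funP f. Qed.

Lemma topdual_continuous f : continuous f.
Proof. by have /asboolP[] := topdual_funP f. Qed.

HB.instance Definition _ f :=
  GRing.isLinear.Build R X R *%R (topdual_fun f) (topdual_linear f).

Lemma topdualP f g : (forall x, f x = g x) -> f = g.
Proof. by move=> fg; apply: val_inj; apply/funext. Qed.

Lemma topdualDE f g x : (f + g) x = f x + g x. Proof. by []. Qed.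
Lemma topdualNE f x : (- f) x = - f x. Proof. by []. Qed.
Lemma topdualZE (k : R) f x : (k *: f) x = k * f x. Proof. by []. Qed.
Lemma topdual0E x : (0 : topdual X) x = 0. Proof. by []. Qed.

Lemma functional_norm_ge0 (g : X -> R) : (0 <= functional_norm g)%E.
Proof.
apply: (@le_trans _ _ `|g 0|%:E); first by rewrite lee_fin.
by apply: ereal_sup_ubound; exists 0 => //=; rewrite normr0.
Qed.

Lemma functional_norm_le (g : X -> R) (c : R) : 0 <= c ->
  (forall x, `|g x| <= c * `|x|) -> (functional_norm g <= c%:E)%E.
Proof.
move=> c0 gc; apply: ge_ereal_sup => _ [x /= x1 <-]; rewrite lee_fin.
by rewrite (le_trans (gc x))// ler_piMr.
Qed.

Lemma functional_norm_fin_num f : functional_norm f \is a fin_num.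
Proof.
pose h : {linear X -> R^o} :=
  HB.pack (topdual_fun f) (GRing.isLinear.Build R X R^o _ (topdual_fun f)
    (topdual_linear f)).
have : bounded_near h (nbhs (0 : X)).
  by apply: continuous_linear_bounded; exact: topdual_continuous.
move=> /linear_boundedP[r [_ hr]].
rewrite ge0_fin_numE ?functional_norm_ge0//.
pose c := `|r| + 1.
have cr : r < c by rewrite /c ltr_pwDr// ler_norm.
apply: (@le_lt_trans _ _ c%:E); last by rewrite ltry.
by apply: functional_norm_le => [|x]; [rewrite /c addr_ge0|exact: hr].
Qed.

Definition topdual_norm f : R := fine (functional_norm f).

Lemma topdual_normE f : (topdual_norm f)%:E = functional_norm f.
Proof. by rewrite fineK// functional_norm_fin_num. Qed.

Lemma topdual_norm_le f (c : R) : 0 <= c ->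
  (forall x, `|f x| <= c * `|x|) -> topdual_norm f <= c.
Proof. by move=> c0 fc; rewrite -lee_fin topdual_normE functional_norm_le. Qed.

Lemma topdual_norm_ge0 f : 0 <= topdual_norm f.
Proof. by rewrite -lee_fin topdual_normE functional_norm_ge0. Qed.

Lemma le_topdual_norm f x : `|f x| <= topdual_norm f * `|x|.
Proof.
have [->|x0] := eqVneq x 0; first by rewrite linear0 !normr0 mulr0.
have nx : 0 < `|x| by rewrite normr_gt0.
rewrite -ler_pdivrMr// -lee_fin topdual_normE; apply: ereal_sup_ubound.
exists (`|x|^-1 *: x) => /=.
  by rewrite normrZ gtr0_norm ?invr_gt0// mulVf ?gt_eqF.
by rewrite linearZ/= normrM gtr0_norm ?invr_gt0// mulrC.
Qed.

Fact topdual_ler_normD f g :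
  topdual_norm (f + g) <= topdual_norm f + topdual_norm g.
Proof.
apply: topdual_norm_le => [|x]; first by rewrite addr_ge0 ?topdual_norm_ge0.
by rewrite topdualDE (le_trans (ler_normD _ _))// mulrDl lerD// le_topdual_norm.
Qed.

Fact topdual_normrZ (k : R) f : topdual_norm (k *: f) = `|k| * topdual_norm f.
Proof.
have le_normrZ (l : R) (h : topdual X) :
    topdual_norm (l *: h) <= `|l| * topdual_norm h.
  apply: topdual_norm_le => [|x]; first by rewrite mulr_ge0 ?topdual_norm_ge0.
  by rewrite topdualZE normrM -mulrA ler_wpM2l// le_topdual_norm.
apply/eqP; rewrite eq_le le_normrZ/=.
have [->|k0] := eqVneq k 0; first by rewrite normr0 mul0r topdual_norm_ge0.
rewrite -ler_pdivlMl ?normr_gt0// -normfV.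
by rewrite -[leLHS](congr1 topdual_norm (scalerK k0 f)) le_normrZ.
Qed.

Fact topdual_normr0_eq0 f : topdual_norm f = 0 -> f = 0.
Proof.
move=> f0; apply: topdualP => x; apply/normr0_eq0/le_anti.
by rewrite normr_ge0 (le_trans (le_topdual_norm f x))// f0 mul0r.
Qed.

HB.instance Definition _ := @Lmodule_isNormed.Build R (topdual X)
  topdual_norm topdual_ler_normD topdual_normrZ topdual_normr0_eq0.

Lemma topdual_normrE f : `|f| = topdual_norm f. Proof. by []. Qed.

End topdual_normed.

Section topdual_complete.
Context {R : realType} {X : normedModType R}.

Fact topdual_complete (F : set_system (topdual X)) :
  ProperFilter F -> cauchy F -> cvg F.
Proof.
move=> FF Fc.
have Fe (e : R) : 0 < e -> exists2 A, F A &
    forall f g : topdual X, A f -> A g -> forall x, `|f x - g x| <= e * `|x|.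
  move=> e0; have /cauchyP/(_ (e / 2))[|f0 Ff0] := Fc.
    by rewrite divr_gt0.
  exists (ball f0 (e / 2)) => // f g.
  rewrite -!ball_normE /ball_/= => f0f f0g x.
  rewrite -[f x - g x]/((f - g) x).
  rewrite (le_trans (le_topdual_norm _ _))// ler_wpM2r// -topdual_normrE.
  rewrite (splitr e) -(subrKA f0) (le_trans (ler_normD _ _))// ltW//.
  by rewrite ltrD// distrC.
have evF x : cvg ((f : topdual X) x @[f --> F]).
  apply: cauchy_cvg; apply: cauchy_exP => _/posnumP[e].
  have d0 : 0 < e%:num / (`|x| + 1) by rewrite divr_gt0// ltr_wpDl.
  have [A FA Ad] := Fe _ d0; have [f0 Af0] := filter_ex FA.
  exists (f0 x); rewrite nbhs_simpl/=; apply: filterS FA => f Af /=.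
  rewrite -ball_normE /ball_/=; apply: (le_lt_trans (Ad _ _ Af0 Af x)).
  by rewrite mulrAC -mulrA gtr_pMr// ltr_pdivrMr ?mul1r ?ltrDl// ltr_wpDl.
pose g x := lim ((f : topdual X) x @[f --> F]).
have gA (e : R) (A : set (topdual X)) (f : topdual X) : F A -> A f ->
    (forall f1 f2 : topdual X, A f1 -> A f2 ->
      forall x, `|f1 x - f2 x| <= e * `|x|) ->
    forall x, `|f x - g x| <= e * `|x|.
  move=> FA Af Ae x.
  have cfg : `|f x - (h : topdual X) x| @[h --> F] --> `|f x - g x|.
    by apply: cvg_norm; apply: cvgB (evF x); exact: cvg_cst.
  apply: (cvgr_to_le cfg).
  by apply: filterS FA => h Ah /=; exact: Ae.
have lg : scalar g.
  move=> k u v; apply: cvg_lim => //.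
  under eq_fun do rewrite linearP/=.
  by apply: cvgD (evF v); apply: cvgMr; exact: (evF u).
pose h : {linear X -> R^o} := HB.pack g (GRing.isLinear.Build R X R^o _ g lg).
have cg : continuous g.
  apply: (@bounded_linear_continuous _ _ _ h); apply/bounded_funP => r.
  have [A FA Ad] := Fe 1 ltr01; have [f0 Af0] := filter_ex FA.
  exists ((`|f0| + 1) * r) => x xr /=.
  rewrite -(subrKC (f0 x) (g x)) (le_trans (ler_normD _ _))//.
  rewrite (@le_trans _ _ ((`|f0| + 1) * `|x|))//; last first.
    by rewrite ler_wpM2l// addr_ge0.
  rewrite mulrDl lerD ?le_topdual_norm// distrC.
  exact: gA FA Af0 Ad x.
have gP : g \in @continuous_functional R X by apply/asboolP; split.
apply/cvg_ex; exists (Topdual gP); apply/cvgrPdist_le => _/posnumP[e].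
have [A FA Ad] := Fe _ (gt0 e).
apply: filterS (FA) => f Af; rewrite distrC topdual_normrE.
by apply: topdual_norm_le => // x; exact: (gA _ _ _ FA Af Ad).
Qed.

HB.instance Definition _ := Uniform_isComplete.Build (topdual X) topdual_complete.

End topdual_complete.

Section canonical_embedding.
Context {R : realType} {X : normedModType R}.

Fact evaluationP (x : X) :
  (fun f : topdual X => f x) \in @continuous_functional R (topdual X).
Proof.
pose ev (f : topdual X) : R^o := f x.
have lev : linear ev by [].
pose h : {linear topdual X -> R^o} :=
  HB.pack ev (GRing.isLinear.Build R (topdual X) R^o _ ev lev).
apply/asboolP; split=> //.
apply: (@bounded_linear_continuous _ _ _ h); apply/bounded_funP => r.
exists (r * `|x|) => f fr /=.
by rewrite (le_trans (le_topdual_norm f x))// ler_wpM2r.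
Qed.

Definition canonical_embedding (x : X) : topdual (topdual X) :=
  Topdual (evaluationP x).

End canonical_embedding.

Definition separable (T : topologicalType) : Prop :=
  exists2 D : set T, countable D & dense D.

(** Measurability for the Borel sigma-algebra of the codomain. *)
Definition borel_measurable d (M : measurableType d) (R : realType)
    (Y : normedModType R) (F : M -> Y) : Prop :=
  measurable_fun setT (F : M -> g_sigma_algebraType (@open Y)).

Section pettis.
Context {d : measure_display} {M : measurableType d} {R : realType}.
Context (mu : {measure set M -> \bar R}) {X : completeNormedModType R}.
Implicit Types (F : M -> X) (E : set M).

Definition is_pettis_integral E F (y : X) : Prop :=
  forall g : topdual X,
    mu.-integrable E (fun t => (g (F t))%:E) /\
    (g y)%:E = (\int[mu]_(t in E) (g (F t))%:E)%E.

Definition pettis_integrable F : Prop :=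
  forall E, measurable E -> exists y, is_pettis_integral E F y.

(** The value is unique when it exists, since [topdual X] separates points. *)
Definition pettis_integral E F : X := xget 0 (is_pettis_integral E F).

End pettis.

Record continuous_schauder_frame d (M : measurableType d) (R : realType)
    (mu : {measure set M -> \bar R}) (X : completeNormedModType R)
    (x : M -> X) (f : M -> topdual X) : Prop := {
  csf_separable : separable X ;
  csf_measurable :
    borel_measurable (fun t => (x t, f t) : (X * topdual X)%type) ;
  csf_integrable : forall v : X, pettis_integrable mu (fun t => f t v *: x t) ;
  csf_reconstruction : forall v : X,
    v = pettis_integral mu setT (fun t => f t v *: x t) }.

Section shrinking.
Context {d : measure_display} {M : measurableType d} {R : realType}.
Context (mu : {measure set M -> \bar R}) {X : completeNormedModType R}.
Context (x : M -> X) (f : M -> topdual X).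

Definition frame_domain : set (set M) :=
  [set E | [/\ measurable E, (mu E < +oo)%E &
    (ereal_sup [set (`|f t| * `|x t|)%:E | t in E] < +oo)%E]].

(** The filter of tails of [frame_domain] directed by inclusion. *)
Definition frame_net : set_system (set M) :=
  filter_from frame_domain
    (fun E => [set E' | frame_domain E' /\ E `<=` E']).

Lemma frame_domain0 : frame_domain set0.
Proof.
split; [exact: measurable0|by rewrite measure0 ltry|].
by rewrite image_set0 ereal_sup0.
Qed.

Lemma frame_domainU (E1 E2 : set M) :
  frame_domain E1 -> frame_domain E2 -> frame_domain (E1 `|` E2).
Proof.
move=> [mE1 fE1 bE1] [mE2 fE2 bE2]; split; first exact: measurableU.
  by apply: le_lt_trans (measureU2 mu mE1 mE2) _; rewrite lte_add_pinfty.
set b1 := ereal_sup _ in bE1; set b2 := ereal_sup _ in bE2.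
apply: (@le_lt_trans _ _ (Order.max b1 b2)); last by rewrite gt_max bE1 bE2.
apply: ge_ereal_sup => _ [t [E1t|E2t] <-]; rewrite le_max.
  by apply/orP; left; apply: ereal_sup_ubound; exists t.
by apply/orP; right; apply: ereal_sup_ubound; exists t.
Qed.

Global Instance frame_net_filter : ProperFilter frame_net.
Proof.
apply: filter_from_proper.
  apply: filter_from_filter; first by exists set0; exact: frame_domain0.
  move=> E1 E2 DE1 DE2; exists (E1 `|` E2); first exact: frame_domainU.
  by move=> E [DE]; rewrite subUset => -[sE1 sE2]; split; split.
by move=> E DE; exists E; split.
Qed.

Definition tail_operator (E : set M) : X -> X :=
  fun v => pettis_integral mu (~` E) (fun t => f t v *: x t).

Definition adjoint (T : X -> X) (g : topdual X) : X -> R := g \o T.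

Definition shrinking : Prop := forall g : topdual X,
  functional_norm (adjoint (tail_operator E) g) @[E --> frame_net] --> 0%E.

End shrinking.

(* Main.v *)
From HB Require Import structures.
Require Import Defs.
From mathcomp Require Import all_boot all_order all_algebra.
From mathcomp Require Import all_classical all_reals all_analysis.
From mathcomp Require Import measurable_realfun ring lra.
Import Order.TTheory GRing.Theory Num.Theory.
Import numFieldNormedType.Exports.

Local Open Scope classical_set_scope.
Local Open Scope ring_scope.

Set Implicit Arguments.
Unset Strict Implicit.
Unset Printing Implicit Defensive.

(** Fix sets [S n] of finite measure increasing to [M] on which [|x t|] and
    [|f t|] are at most [n], and let [y A] be the weak-star integral of
    [g (x t) *: f t] over [A]; then [y (~` E)] is the adjoint of the tail
    operator of [E] applied to [g], and [y setT = g]. Both sides of the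
    equivalence amount to: [|y A|] is uniformly small for [A] disjoint from
    [S n], [n] large.

    If the frame is shrinking, take [E0] in the net past which the tails are
    small. For [A] disjoint from [E0], [y (A `&` S m)] is the difference of the
    tails of [E0] and of [E0 `|` (A `&` S m)]; let [m] grow to bound [|y A|]. The
    part inside [E0] is controlled by [mu (E0 `\` S n) --> 0]. Hence [g]
    is a norm limit of [y (S n)]; since [x] has separable range, [y (S n)] lies
    in a fixed separable subspace, so the dual of [X] is separable. On [S n] the
    integrand is then bounded with separable range, its integral commutes with
    every functional of the bidual, and smallness of the tails extends this to
    all measurable sets.

    Conversely, if the dual of [X] is separable, smallness of the tails is an
    Orlicz-Pettis theorem, obtained here from a Baire category argument on the
    measurable sets. *)

(** * Separability: dense sequences and dense spans *)

Lemma separable_seq {R : realType} (Y : normedModType R) : separable Y ->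
  exists h : nat -> Y, forall y e, 0 < e -> exists j, `|y - h j| < e.
Proof.
move=> [D cD dD].
have nb (y : Y) (e : R) : 0 < e -> (ball y e `&` D) !=set0.
  move=> e0; have [|z [yz Dz]] := dD (ball y e)° _ (@open_interior _ _).
    by exists y; rewrite /interior; exact: nbhsx_ballx.
  by exists z; split=> //; exact: interior_subset yz.
move/pfcard_geP: cD => [D0|[h]].
  by have [z []] := nb 0 1 ltr01; rewrite D0.
exists h => y e /(nb y)[z [yz /(@surj _ _ _ _ h)[j _ hj]]]; exists j.
by rewrite hj; rewrite -ball_normE in yz.
Qed.

(** Real coefficients can be moved to nearby rationals one term at a time, and the rational
    combinations of a countable family form a countable set. *)
Lemma separable_span {R : realType} (Y : normedModType R) (I : countType)
    (e : I -> Y) :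
  (forall y r, 0 < r -> exists s : seq (R * I),
    `|y - \sum_(p <- s) p.1 *: e p.2| <= r) ->
  separable Y.
Proof.
move=> eY.
have rat_approx (s : seq (R * I)) (r : R) : 0 < r -> exists s' : seq (rat * I),
    `|\sum_(p <- s) p.1 *: e p.2 - \sum_(p <- s') ratr p.1 *: e p.2| < r.
  elim: s r => [|[c i] s IH] r r0.
    by exists [::]; rewrite !big_nil subrr normr0.
  have r2 : 0 < r / 2 by rewrite divr_gt0.
  have [s' s'P] := IH _ r2.
  have e1 : 0 < `|e i| + 1 by rewrite ltr_wpDl.
  have d0 : 0 < r / 2 / (`|e i| + 1) by rewrite divr_gt0.
  have /rat_in_itvoo[q] : c - r / 2 / (`|e i| + 1) < c by rewrite ltrBlDr ltrDl.
  rewrite in_itv/= => /andP[cq qc].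
  exists ((q, i) :: s'); rewrite !big_cons/= opprD addrACA -scalerBl.
  rewrite (le_lt_trans (ler_normD _ _))// (splitr r) ler_ltD// normrZ.
  rewrite gtr0_norm ?subr_gt0//.
  rewrite (@le_trans _ _ (r / 2 / (`|e i| + 1) * (`|e i| + 1)))//.
    by rewrite ler_pM ?subr_ge0 ?(ltW qc)//; lra.
  by rewrite divfK ?gt_eqF.
exists (range (fun s : seq (rat * I) => \sum_(p <- s) ratr p.1 *: e p.2)).
  by apply: sub_countable (card_image_le _ _) _; exact: countableP.
move=> O [y Oy] oO.
have /nbhs_ballP[r/= r0 yrO] : nbhs y O by exact: open_nbhs_nbhs.
have r2 : 0 < r / 2 by rewrite divr_gt0.
have [s ys] := eY y _ r2; have [s' ss'] := rat_approx s _ r2.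
exists (\sum_(p <- s') ratr p.1 *: e p.2); split; last by exists s'.
apply: yrO; rewrite -ball_normE /ball_/=.
rewrite -(subrKA (\sum_(p <- s) p.1 *: e p.2)).
by rewrite (le_lt_trans (ler_normD _ _))// (splitr r) ler_ltD.
Qed.

(** * Norm estimates for functionals *)

Section topdual_facts.
Context {R : realType} {X : normedModType R}.

Lemma ler_topdual (g : topdual X) v : `|g v| <= `|g| * `|v|.
Proof. exact: le_topdual_norm. Qed.

Lemma topdual_ler_norm (g : topdual X) (c : R) : 0 <= c ->
  (forall v, `|g v| <= c * `|v|) -> `|g| <= c.
Proof. exact: topdual_norm_le. Qed.

Lemma topdual_lt_norm (g : topdual X) (c : R) : 0 <= c -> c < `|g| ->
  exists v, c * `|v| < `|g v|.
Proof.
move=> c0; apply: contraPP => /forallNP gc; apply/negP; rewrite -leNgt.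
by apply: topdual_ler_norm => // v; rewrite leNgt; apply/negP.
Qed.

Lemma bounded_scalar_topdual (l : X -> R) (c : R) : scalar l ->
  (forall v, `|l v| <= c * `|v|) -> exists g : topdual X, forall v, g v = l v.
Proof.
move=> ll lc.
pose h : {linear X -> R^o} := HB.pack l (GRing.isLinear.Build R X R^o _ l ll).
have cl : continuous l.
  apply: (@bounded_linear_continuous _ _ _ h); apply/bounded_funP => r.
  exists (`|c| * `|r|) => v vr /=; rewrite (le_trans (lc v))//.
  rewrite (le_trans (ler_norm _))// normrM normr_id ler_wpM2l//.
  by rewrite (le_trans vr)// ler_norm.
have gP : l \in @continuous_functional R X by apply/asboolP; split.
by exists (Topdual gP).
Qed.

(** Continuity of [h] is not assumed, so that the bound applies to adjoints of tail operators, which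
    are only known to be linear. The proof rescales [v] to the unit sphere. *)
Lemma functional_norm_bound (h : X -> R) (c : R) :
  scalar h -> (functional_norm h <= c%:E)%E -> forall v, `|h v| <= c * `|v|.
Proof.
move=> hl hc v.
have h0 : h 0 = 0 by have := hl (-1) 0 0; rewrite scaler0 addr0 mulN1r addNr.
have hZ k u : h (k *: u) = k * h u by have := hl k u 0; rewrite !addr0 h0 addr0.
 have [->|v0] := eqVneq v 0.
  by rewrite -(scale0r 0) hZ mul0r scale0r !normr0 mulr0.
have nv : 0 < `|v| by rewrite normr_gt0.
have vE : `|h v| = `|h (`|v|^-1 *: v)| * `|v|.
  by rewrite hZ normrM gtr0_norm ?invr_gt0// mulrAC mulVf ?gt_eqF// mul1r.
rewrite vE ler_wpM2r// -lee_fin (le_trans _ hc)//; apply: ereal_sup_ubound.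
exists (`|v|^-1 *: v) => //=.
by rewrite normrZ gtr0_norm ?invr_gt0// mulVf ?gt_eqF.
Qed.

End topdual_facts.

(** * Borel measurability under continuous maps *)

Section borel.
Context {d : measure_display} {M : measurableType d} {R : realType}.

Lemma borel_measurable_comp (Y Z : normedModType R) (F : M -> Y) (k : Y -> Z) :
  continuous k -> borel_measurable F -> borel_measurable (k \o F).
Proof.
move=> ck mF.
apply: (@measurability _ _ M (g_sigma_algebraType (@open Z)) setT _ (@open Z)).
  by [].
move=> _ [B oB <-]; rewrite setTI comp_preimage -[X in measurable X]setTI.
apply: mF => //; apply: sub_gen_smallest.
by move/continuousP: ck; exact.
Qed.

Lemma borel_measurable_fun (Y : normedModType R) (F : M -> Y) (k : Y -> R) :
  continuous k -> borel_measurable F -> measurable_fun setT (k \o F).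
Proof.
move=> ck mF; apply: (measurability _ (RGenOpens.measurableE R)).
move=> _ [_ [a [b ->] <-]]; rewrite setTI comp_preimage -[X in measurable X]setTI.
apply: mF => //; apply: sub_gen_smallest.
by move/continuousP: ck; apply; exact: interval_open.
Qed.

Lemma borel_measurable_dist (Y : normedModType R) (F : M -> Y) (y : Y) :
  borel_measurable F -> measurable_fun setT (fun t => `|F t - y|).
Proof.
apply: (@borel_measurable_fun _ _ (fun z => `|z - y|)).
by move=> z; apply: cvg_norm; apply: cvgB; [exact: cvg_id|exact: cvg_cst].
Qed.

End borel.

(** * Integration along an exhausting sequence of sets *)

Section exhausting.
Context {d : measure_display} {M : measurableType d} {R : realType}.
Implicit Types (A E : set M) (u : M -> R) (S : (set M)^nat).

Definition exhausting S :=
  [/\ forall n, measurable (S n), nondecreasing_seq S & \bigcup_n S n = setT].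

Context (mu : {measure set M -> \bar R}).

Lemma bounded_integrable A u (c : R) : measurable A -> (mu A < +oo)%E ->
  measurable_fun setT u -> (forall t, A t -> `|u t| <= c) ->
  mu.-integrable A (EFin \o u).
Proof.
move=> mA fA mu_ uc; apply: measurable_bounded_integrable => //.
  exact: measurable_funTS.
exists c; split; first exact: num_real.
by move=> r cr t At; apply: le_trans (uc t At) (ltW cr).
Qed.

Lemma normr_Rintegral_le A u (c : R) : measurable A -> (mu A < +oo)%E ->
  mu.-integrable A (EFin \o u) -> (forall t, A t -> `|u t| <= c) ->
  `|\int[mu]_(t in A) u t| <= c * fine (mu A).
Proof.
move=> mA fA iu uc; rewrite (le_trans (le_normr_Rintegral mA iu))//.
rewrite -Rintegral_cst//; apply: le_Rintegral => //; first exact: integrable_norm.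
by apply: (@bounded_integrable A _ `|c|).
Qed.

Lemma fine_le_measure A E : measurable A -> measurable E -> A `<=` E ->
  (mu E < +oo)%E -> fine (mu A) <= fine (mu E).
Proof.
move=> mA mE AE fE; have AE' : (mu A <= mu E)%E by rewrite le_measure ?inE.
by rewrite fine_le// ge0_fin_numE// (le_lt_trans AE').
Qed.

Lemma ge0_le_Rintegral_subset A E u : measurable A -> measurable E ->
  A `<=` E -> mu.-integrable E (EFin \o u) -> (forall t, E t -> 0 <= u t) ->
  \int[mu]_(t in A) u t <= \int[mu]_(t in E) u t.
Proof.
move=> mA mE AE iu u0; rewrite /Rintegral fine_le//.
- by apply: integrable_fin_num => //; exact: integrableS iu.
- exact: integrable_fin_num.
- by apply: ge0_subset_integral => //; case/integrableP : iu.
Qed.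

(** By monotone convergence the integral of [|u|] over the part of [E] in [S n] tends to that over
    [E]. A set [A] disjoint from [S m] lies in the gap, so [n] depends neither on [A] nor on [m]. *)
Lemma exhausting_small_tail S E u (r : R) : exhausting S -> measurable E ->
  mu.-integrable E (EFin \o u) -> 0 < r ->
  exists n, forall m A, (n <= m)%N -> measurable A -> A `<=` E ->
    A `&` S m = set0 -> `|\int[mu]_(t in A) u t| <= r.
Proof.
move=> [mS ndS SE] mE iu r0.
have mES n : measurable (E `&` S n) by exact: measurableI.
have ndES : nondecreasing_seq (fun n => E `&` S n).
  by move=> i j ij; apply/subsetPset; apply: setIS; apply/subsetPset; exact: ndS.
have iau : mu.-integrable E (EFin \o (fun t => `|u t|)) by exact: integrable_norm.
pose v : M -> \bar R := EFin \o (fun t => `|u t|).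
have mau i : measurable_fun (E `&` S i) v.
  by apply: measurable_funS (measurable_int _ iau).
have := @ge0_nondecreasing_set_cvg_integral _ _ _ _ v mu
  ndES mES mau (fun _ _ _ => normr_ge0 _).
rewrite -setI_bigcupr SE setIT -[X in _ --> X]fineK; last first.
  exact: integrable_fin_num.
move=> /fine_cvgP[_ /cvgrPdist_le/(_ _ r0)[n _ nP]].
exists n => m A nm mA AE AS0.
have ASn : A `&` (E `&` S n) = set0.
  rewrite -subset0 => t [At [_ Snt]]; rewrite -AS0; split=> //.
  by have /subsetPset := ndS _ _ nm; exact.
have iA : mu.-integrable A (EFin \o u) by exact: integrableS iu.
rewrite (le_trans (le_normr_Rintegral mA iA))//.
have {nP} := nP n (leqnn n); apply: le_trans.
rewrite (le_trans _ (ler_norm _))// lerBrDr -Rintegral_setU//.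
- apply: ge0_le_Rintegral_subset => //; first exact: measurableU.
  by rewrite subUset; split=> //; exact: subIsetl.
- apply: integrableS iau => //; first exact: measurableU.
  by rewrite subUset; split=> //; exact: subIsetl.
- exact/eqP.
Qed.

(** Monotone convergence carries the uniform bound on the integrals of [|u|] over to the whole
    space. *)
Lemma exhausting_integrable S u (c : R) : exhausting S ->
  measurable_fun setT u ->
  (forall n, mu.-integrable (S n) (EFin \o u)) ->
  (forall n, \int[mu]_(t in S n) `|u t| <= c) ->
  mu.-integrable setT (EFin \o u).
Proof.
move=> [mS ndS SE] mu_ iu uc; apply/integrableP.
split; first exact/measurable_EFinP.
pose v : M -> \bar R := EFin \o (fun t => `|u t|).
have mau i : measurable_fun (S i) v.
  by apply/measurable_EFinP/measurableT_comp => //; exact: measurable_funTS.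
have := @ge0_nondecreasing_set_cvg_integral _ _ _ _ v mu
  ndS mS mau (fun _ _ _ => normr_ge0 _).
rewrite SE => cu; apply: (@le_lt_trans _ _ c%:E); last exact: ltry.
apply: (cvge_to_le cu); apply: nearW => n /=.
have iv : mu.-integrable (S n) v by exact: integrable_norm.
by rewrite -(fineK (integrable_fin_num (mS n) iv)) lee_fin; exact: uc.
Qed.

Lemma Rintegral_setD E A u : measurable A -> measurable E ->
  mu.-integrable E (EFin \o u) ->
  \int[mu]_(t in E) u t =
  \int[mu]_(t in E `&` A) u t + \int[mu]_(t in E `\` A) u t.
Proof.
move=> mA mE iu; rewrite -Rintegral_setU ?setUIDK//.
- exact: measurableI.
- exact: measurableD.
- by apply/eqP; rewrite -subset0 => t [[_ At] [_ ]].
Qed.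

End exhausting.

(** * Approximation by functions constant on countably many pieces *)

Section simple_approximation.
Context {d : measure_display} {M : measurableType d} {R : realType}.
Context (mu : {measure set M -> \bar R}).
Implicit Types (A : set M) (B : (set M)^nat) (u : M -> R).

(** The parts of [B j] inside [peel A B j] are the usual disjointification of [B] within [A];
    [peel A B n] is the remainder after [n] steps. *)
Fixpoint peel A B (n : nat) : set M :=
  if n is m.+1 then peel A B m `\` B m else A.

Lemma measurable_peel A B n : measurable A -> (forall j, measurable (B j)) ->
  measurable (peel A B n).
Proof. by move=> mA mB; elim: n => //= n IH; exact: measurableD. Qed.

Lemma peel_sub A B n : peel A B n `<=` A.
Proof. by elim: n => //= n IH t [/IH]. Qed.

(** The pieces already removed cost at most [e] times their total measure, and the remainder costs
    at most [c] times its measure. *)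
Lemma Rintegral_peel A B u (w : nat -> M -> R) (e c : R) n :
  0 <= e -> measurable A -> (mu A < +oo)%E -> (forall j, measurable (B j)) ->
  mu.-integrable A (EFin \o u) ->
  (forall j, mu.-integrable (peel A B j `&` B j) (EFin \o w j)) ->
  (forall j t, (peel A B j `&` B j) t -> `|u t - w j t| <= e) ->
  (forall t, A t -> `|u t| <= c) ->
  `|\int[mu]_(t in A) u t -
    \sum_(j < n) \int[mu]_(t in peel A B j `&` B j) w j t| <=
  e * fine (mu A) + c * fine (mu (peel A B n)).
Proof.
move=> e0 mA fA mB iu iw uw uc.
have mP j := @measurable_peel A B j mA mB.
have mPB j : measurable (peel A B j `&` B j) by exact: measurableI.
have fP E : measurable E -> E `<=` A -> (mu E < +oo)%E.
  by move=> mE EA; rewrite (le_lt_trans _ fA)// le_measure ?inE.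
have fPB j : (mu (peel A B j `&` B j) < +oo)%E.
  by apply: fP => // t [/peel_sub].
have fpeel j : (mu (peel A B j) < +oo)%E by exact: fP (@peel_sub A B j).
have iP j : mu.-integrable (peel A B j) (EFin \o u).
  by apply: integrableS iu => //; exact: peel_sub.
have iPB j : mu.-integrable (peel A B j `&` B j) (EFin \o u).
  by apply: integrableS (iP j) => //; exact: subIsetl.
(* Keeping the integral over the remainder explicit makes the induction exact: each step pays [e]
   times the measure of the piece just removed. *)
have main m : `|\int[mu]_(t in A) u t -
    \sum_(j < m) \int[mu]_(t in peel A B j `&` B j) w j t -
    \int[mu]_(t in peel A B m) u t| <=
    e * (fine (mu A) - fine (mu (peel A B m))).
  elim: m => [|m IH]; first by rewrite big_ord0 subr0 !subrr normr0 mulr0.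
  rewrite big_ord_recr/=.
  have -> : fine (mu (peel A B m `\` B m)) =
      fine (mu (peel A B m)) - fine (mu (peel A B m `&` B m)).
    have i1 : mu.-integrable (peel A B m) (EFin \o cst 1).
      by apply: (@bounded_integrable _ _ _ _ _ _ 1) => // t _; rewrite normr1.
    have := @Rintegral_setD _ _ _ mu (peel A B m) (B m) (cst 1) (mB m) (mP m) i1.
    rewrite !Rintegral_cst ?mul1r//; last exact: measurableD.
    by move=> ->; rewrite addrAC subrr add0r.
  have -> : \int[mu]_(t in peel A B m `\` B m) u t = \int[mu]_(t in peel A B m) u t
      - \int[mu]_(t in peel A B m `&` B m) u t.
    by rewrite (Rintegral_setD (E := peel A B m) (mB m))// addrAC subrr add0r.
  have dB : `|\int[mu]_(t in peel A B m `&` B m) u t -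
      \int[mu]_(t in peel A B m `&` B m) w m t| <=
      e * fine (mu (peel A B m `&` B m)).
    rewrite -RintegralB//; apply: normr_Rintegral_le => //.
    exact: (integrableB (mPB m) (iPB m) (iw m)).
    by move=> t; exact: uw.
  have {dB}/ler_normlP[d1 d2] := dB; have {IH}/ler_normlP[h1 h2] := IH.
  by apply/ler_normlP; split; lra.
have pc : `|\int[mu]_(t in peel A B n) u t| <= c * fine (mu (peel A B n)).
  by apply: normr_Rintegral_le => // t /peel_sub; exact: uc.
have ee : 0 <= e * fine (mu (peel A B n)) by rewrite mulr_ge0.
have /ler_normlP[d1 d2] := pc; have /ler_normlP[h1 h2] := main n.
by apply/ler_normlP; split; lra.
Qed.

(** The remainders decrease to the empty set because the [B j] cover [A]; continuity from above
    applies since [mu A] is finite. *)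
Lemma peel_small A B (r : R) : measurable A -> (mu A < +oo)%E ->
  (forall j, measurable (B j)) -> (forall t, A t -> exists j, B j t) -> 0 < r ->
  exists n, fine (mu (peel A B n)) <= r.
Proof.
move=> mA fA mB AB r0.
have mP j := @measurable_peel A B j mA mB.
have P0 : \bigcap_j peel A B j = set0.
  rewrite -subset0 => t Pt; have [j Bjt] := AB t (Pt 0%N I).
  by have [] := Pt j.+1 I.
have niP : nonincreasing_seq (peel A B).
  by apply/nonincreasing_seqP => j; apply/subsetPset => t [].
have mI : measurable (\bigcap_j peel A B j) by rewrite P0.
have := nonincreasing_cvg_mu fA mP mI niP.
rewrite P0 measure0 => /fine_cvgP[_ /cvgrPdist_le/(_ _ r0)[n _ nP]].
exists n; have := nP n (leqnn n); rewrite sub0r normrN.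
exact: le_trans (ler_norm _).
Qed.

(** Closed balls around a dense sequence cover [Y]. The single parameter [r] is both their radius
    and the bound on the measure left over. *)
Lemma peel_approx (Y : normedModType R) (F : M -> Y) (h : nat -> Y) A (r : R) :
  borel_measurable F -> (forall y e, 0 < e -> exists j, `|y - h j| < e) ->
  measurable A -> (mu A < +oo)%E -> 0 < r ->
  let B := fun j => [set t | `|F t - h j| <= r] in
  (forall j, measurable (B j)) /\ exists n, fine (mu (peel A B n)) <= r.
Proof.
move=> mF hd mA fA r0 B.
have mB j : measurable (B j).
  rewrite /B -[X in measurable X]setTI.
  have -> : [set t | `|F t - h j| <= r] = (fun t => `|F t - h j|) @^-1` `]-oo, r].
    by apply/seteqP; split=> t /=; rewrite in_itv.
  by apply: (borel_measurable_dist (h j) mF) => //; exact: measurable_itv.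
split=> //; apply: peel_small => // t _.
by have [j hj] := hd (F t) _ r0; exists j; exact: ltW.
Qed.

End simple_approximation.

Lemma le_forall_addM {R : realType} (a b c : R) :
  (forall e, 0 < e -> a <= b + c * e) -> a <= b.
Proof.
move=> h; rewrite leNgt; apply/negP => ba.
have d0 : 0 < (a - b) / 2 / (`|c| + 1).
  by rewrite !divr_gt0 ?subr_gt0// ltr_wpDl.
have := h _ d0; apply/negP; rewrite -ltNge.
have : c * ((a - b) / 2 / (`|c| + 1)) <= (a - b) / 2.
  rewrite mulrCA ler_piMr ?divr_ge0 ?subr_ge0 ?(ltW ba)//.
  by rewrite ler_pdivrMr ?mul1r ?ltr_wpDl// (le_trans (ler_norm c))// lerDl.
by lra.
Qed.

(** * Functionals of the bidual and weak-star integrals *)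

Section bochner.
Context {d : measure_display} {M : measurableType d} {R : realType}.
Context (mu : {measure set M -> \bar R}) {X : normedModType R}.

Lemma borel_measurable_functional (Y : normedModType R) (F : M -> Y)
    (g : topdual Y) : borel_measurable F -> measurable_fun setT (fun t => g (F t)).
Proof. exact: (borel_measurable_fun (@topdual_continuous _ _ g)). Qed.

Lemma borel_measurable_eval (F : M -> topdual X) v :
  borel_measurable F -> measurable_fun setT (fun t => F t v).
Proof. exact: (@borel_measurable_functional _ F (canonical_embedding v)). Qed.

(** One vector [z], the integral of a simple approximation of [F], serves every functional of the
    bidual at once. Evaluations show that [z] is close to [y] in norm; applied to [phi], the same
    estimate compares [phi z] with the integral of [phi] along [F]. *)
Lemma weak_star_integral_functional (F : M -> topdual X) (A : set M) (c : R)
    (y : topdual X) (phi : topdual (topdual X)) :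
  separable (topdual X) -> borel_measurable F ->
  measurable A -> (mu A < +oo)%E -> (forall t, A t -> `|F t| <= c) -> 0 <= c ->
  (forall v, y v = \int[mu]_(t in A) F t v) ->
  phi y = \int[mu]_(t in A) phi (F t).
Proof.
move=> /separable_seq[h hd] mF mA fA Fc c0 yE; apply/eqP; rewrite -subr_eq0.
rewrite -normr_le0.
apply: (@le_forall_addM _ _ _ (2 * `|phi| * (fine (mu A) + c))) => e e0.
have [mB [n nP]] := peel_approx mF hd mA fA e0.
set B := (fun j => _) in mB nP.
pose z := \sum_(j < n) fine (mu (peel A B j `&` B j)) *: h j.
have mPB j : measurable (peel A B j `&` B j).
  exact: (measurableI _ _ (measurable_peel j mA mB) (mB j)).
have fPB j : (mu (peel A B j `&` B j) < +oo)%E.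
  by rewrite (le_lt_trans _ fA)// le_measure ?inE// => t [/peel_sub].
have m0 : 0 <= fine (mu A) by rewrite fine_ge0.
have b0 : 0 <= e * (fine (mu A) + c) by rewrite mulr_ge0 ?addr_ge0// ltW.
have zE (psi : topdual (topdual X)) :
    `|\int[mu]_(t in A) psi (F t) - psi z| <= e * (fine (mu A) + c) * `|psi|.
  have -> : psi z = \sum_(j < n) \int[mu]_(t in peel A B j `&` B j) psi (h j).
    rewrite linear_sum; apply: eq_bigr => j _.
    by rewrite Rintegral_cst// linearZ/= mulrC.
  rewrite (le_trans (@Rintegral_peel _ _ _ mu A B (fun t => psi (F t))
    (fun j _ => psi (h j))
    (`|psi| * e) (`|psi| * c) n _ mA fA mB _ _ _ _))//.
  - by rewrite mulr_ge0 // ltW.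
  - apply: (@bounded_integrable _ _ _ _ _ _ (`|psi| * c)) => //.
      exact: borel_measurable_functional.
    move=> t At; rewrite (le_trans (ler_topdual _ _))// ler_wpM2l//.
    exact: Fc.
  - by move=> j; apply: (@bounded_integrable _ _ _ _ _ _ `|psi (h j)|).
  - move=> j t [_ Bt]; rewrite -linearB (le_trans (ler_topdual _ _))//.
    by rewrite ler_wpM2l.
  - move=> t At; rewrite (le_trans (ler_topdual _ _))// ler_wpM2l//.
    exact: Fc.
  - rewrite -[leRHS]mulrC mulrDr mulrDr mulrA lerD2l mulrA [leRHS]mulrAC.
    by rewrite ler_wpM2l// mulr_ge0.
have yz : `|y - z| <= e * (fine (mu A) + c).
  apply: topdual_ler_norm => // v; rewrite topdualDE topdualNE yE.
  rewrite (le_trans (zE (canonical_embedding v)))// ler_wpM2l//.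
  by apply: topdual_ler_norm => // g; rewrite mulrC; exact: (ler_topdual g v).
have := ler_topdual phi (y - z); rewrite linearB => p1.
have {}p1 : `|phi y - phi z| <= `|phi| * (e * (fine (mu A) + c)).
  by rewrite (le_trans p1)// ler_wpM2l.
rewrite add0r -(subrKA (phi z)) (le_trans (ler_normD _ _))//.
rewrite [X in _ + X <= _]distrC.
by have := lerD p1 (zE phi); lra.
Qed.

End bochner.

(** * An Orlicz-Pettis theorem by Baire category *)

Section orlicz_pettis.
Context {d : measure_display} {M : measurableType d} {R : realType}.
Context (mu : {measure set M -> \bar R}) {X : normedModType R}.
Implicit Types A B : set M.

(** The measurable sets agreeing with [B] on [S n] act as a basic neighbourhood of [B]. Countably
    many balls of radius [r / 2] cover the dual, so one of them must contain the values of [y] on a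
    whole neighbourhood. *)
Lemma weak_star_integral_small_tail (F : M -> topdual X)
    (y : set M -> topdual X) (S : (set M)^nat) (r : R) :
  separable (topdual X) -> exhausting S ->
  (forall v, mu.-integrable setT (EFin \o (fun t => F t v))) ->
  (forall A, measurable A -> forall v, y A v = \int[mu]_(t in A) F t v) ->
  0 < r ->
  exists n, forall A, measurable A -> A `&` S n = set0 -> `|y A| <= r.
Proof.
move=> /separable_seq[h hd] exS iF yE r0.
have [mS ndS _] := exS.
have iFA A v : measurable A -> mu.-integrable A (EFin \o (fun t => F t v)).
  by move=> mA; apply: integrableS (iF v).
have ySD A n v : measurable A -> y A v = y (A `&` S n) v + y (A `\` S n) v.
  move=> mA; rewrite !yE; [|exact: measurableD|exact: measurableI|by []].
  by apply: Rintegral_setD => //; exact: iFA.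
have r2 : 0 < r / 2 by rewrite divr_gt0.
have [[B [n [i [mB BP]]]]|noB] := pselect (exists B n i, measurable B /\
    forall A, measurable A -> A `&` S n = B `&` S n -> `|y A - h i| <= r / 2).
  (* Gluing [A] to the part of [B] in [S n] stays in the neighbourhood, so [y A] is a difference of
     two vectors of norm at most [r / 2]. *)
  exists n => A mA AS0.
  have mBS : measurable (B `&` S n) by exact: measurableI.
  have mU : measurable ((B `&` S n) `|` A) by exact: measurableU.
  have US : ((B `&` S n) `|` A) `&` S n = B `&` S n.
    by rewrite setIUl AS0 setU0 -setIA setIid.
  have UA : ((B `&` S n) `|` A) `\` S n = A.
    apply/seteqP; split=> t /=; first by move=> [[[]|]].
    move=> At; split; first by right.
    by move=> St; have : (A `&` S n) t by []; rewrite AS0.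
  have -> : y A = (y ((B `&` S n) `|` A) - h i) - (y (B `&` S n) - h i).
    apply: topdualP => v; rewrite !(topdualDE, topdualNE).
    by rewrite (ySD _ n v mU) US UA; ring.
  rewrite (le_trans (ler_normB _ _))// (splitr r) lerD//; apply: BP => //.
  by rewrite -setIA setIid.
(* Otherwise the sets [A] with [`|y A - h i| <= r / 2] are nowhere dense for the
   topology of agreement on the [S n], and a Baire category argument yields a
   set avoiding all of them. *)
have step (s : set M * nat) (i : nat) : exists s' : set M * nat,
    measurable s.1 -> [/\ measurable s'.1, (s.2 <= s'.2)%N,
      s'.1 `&` S s.2 = s.1 `&` S s.2 &
      forall A, measurable A -> A `&` S s'.2 = s'.1 `&` S s'.2 ->
        r / 2 < `|y A - h i|].
  have [ms|] := pselect (measurable s.1); last by exists s.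
  have [A [mA As Ai]] : exists A, [/\ measurable A,
      A `&` S s.2 = s.1 `&` S s.2 & r / 2 < `|y A - h i|].
    apply: contrapT => nA; apply: noB; exists s.1, s.2, i; split=> // A mA As.
    by rewrite leNgt; apply/negP => Ai; apply: nA; exists A.
  have [v hv] := topdual_lt_norm (ltW r2) Ai.
  (* A third of the margin by which [v] violates the bound. A set agreeing with [A] on
     [S (maxn s.2 n)] changes the value at [v] by at most [2 e], so the violation persists. *)
  pose e := (`|(y A - h i) v| - r / 2 * `|v|) / 3.
  have e0 : 0 < e by rewrite divr_gt0 ?subr_gt0.
  have [n nP] := exhausting_small_tail exS measurableT (iF v) e0.
  have tail B : measurable B -> `|y (B `\` S (maxn s.2 n)) v| <= e.
    move=> mB; rewrite yE; last exact: measurableD.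
    apply: (nP (maxn s.2 n)); rewrite ?leq_maxr//; first exact: measurableD.
    by rewrite -subset0 => t [[]].
  exists (A, maxn s.2 n) => _; split; rewrite ?leq_maxl//= => B mB BA.
  have BAv : `|y B v - y A v| <= e + e.
    rewrite (ySD B (maxn s.2 n) v mB) (ySD A (maxn s.2 n) v mA) BA opprD addrACA.
    by rewrite subrr add0r (le_trans (ler_normB _ _))// lerD ?tail.
  rewrite ltNge; apply/negP => Bi.
  have := ler_topdual (y B - h i) v; apply/negP; rewrite -ltNge.
  rewrite (@le_lt_trans _ _ (r / 2 * `|v|))// ?ler_wpM2r//.
  move: e0 BAv; rewrite /e !(topdualDE, topdualNE) => e0 BAv.
  have : `|y A v - h i v| <= `|y B v - h i v| + `|y B v - y A v|.
    have -> : y A v - h i v = (y B v - h i v) + (y A v - y B v) by ring.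
    by rewrite [X in _ <= _ + X]distrC ler_normD.
  by lra.
have [f fP] := choice (fun p : (set M * nat) * nat => step p.1 p.2).
pose st := fix st n := if n is m.+1 then f (st m, m) else (set0, 0%N).
have mst n : measurable (st n).1.
  by elim: n => [|n IH] /=; [exact: measurable0|have [] := fP (st n, n) IH].
have stP n := fP (st n, n) (mst n).
have st_le : {homo (fun n => (st n).2) : m n / (m <= n)%N}.
  by apply: homo_leq => [//|? ? ?|n]; [exact: leq_trans|have [] := stP n].
have stS m n : (m <= n)%N ->
    (st n).1 `&` S (st m).2 = (st m).1 `&` S (st m).2.
  elim: n => [|n IH]; first by rewrite leqn0 => /eqP ->.
  rewrite leq_eqVlt => /predU1P[->//|]; rewrite ltnS => mn.
  have [_ _ e _] := stP n.
  have /subsetPset/setIidPr SS := ndS _ _ (st_le _ _ mn).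
  by rewrite -(IH mn) -SS !setIA; congr (_ `&` _).
(* Later stages agree with earlier ones on the earlier [S (st n).2], so this union agrees with every
   stage there. *)
pose A := \bigcup_n ((st n).1 `&` S (st n).2).
have mA : measurable A by apply: bigcupT_measurable => n; exact: measurableI.
have AS n : A `&` S (st n).2 = (st n).1 `&` S (st n).2.
  apply/seteqP; split=> t [+ St]; last by move=> ?; split=> //; exists n.
  move=> [m _ [stt Smt]]; split=> //; have [mn|nm] := leqP m n.
    by have : ((st m).1 `&` S (st m).2) t by []; rewrite -(stS _ _ mn) => -[].
  have : ((st m).1 `&` S (st n).2) t by [].
  by rewrite (stS _ _ (ltnW nm)) => -[].
(* By density [y A] is within [r / 2] of some [h i], which stage [i.+1] has excluded. *)
have [i hi] := hd (y A) _ r2; have [_ _ _ /(_ A mA (AS i.+1))] := stP i.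
by rewrite ltNge (ltW hi).
Qed.

End orlicz_pettis.

(** * Existence and uniqueness of weak-star integrals *)

Section weak_star_integral.
Context {d : measure_display} {M : measurableType d} {R : realType}.
Context (mu : {measure set M -> \bar R}) {X : normedModType R}.
Implicit Types (A : set M) (F : M -> topdual X).

Lemma weak_star_integral_scalar F A : measurable A ->
  (forall v, mu.-integrable A (EFin \o (fun t => F t v))) ->
  scalar (fun v => \int[mu]_(t in A) F t v).
Proof.
move=> mA iF k u v.
rewrite -RintegralZl// -RintegralD//; last exact: (integrableZl mA k (iF u)).
by apply: eq_Rintegral => t _; rewrite linearP.
Qed.

Lemma weak_star_integral_ex F A (c : R) : measurable A ->
  (forall v, mu.-integrable A (EFin \o (fun t => F t v))) ->
  (forall v, `|\int[mu]_(t in A) F t v| <= c * `|v|) ->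
  exists y : topdual X, forall v, y v = \int[mu]_(t in A) F t v.
Proof.
by move=> mA iF; apply: bounded_scalar_topdual; exact: weak_star_integral_scalar.
Qed.

Lemma weak_star_integral_bounded F A (c : R) :
  borel_measurable F -> measurable A -> (mu A < +oo)%E ->
  (forall t, A t -> `|F t| <= c) ->
  (forall v, mu.-integrable A (EFin \o (fun t => F t v))) /\
  forall v, `|\int[mu]_(t in A) F t v| <= c * fine (mu A) * `|v|.
Proof.
move=> mF mA fA Fc; have Fv v t : A t -> `|F t v| <= c * `|v|.
  by move=> At; rewrite (le_trans (ler_topdual _ _))// ler_wpM2r// Fc.
have iF v : mu.-integrable A (EFin \o (fun t => F t v)).
  apply: (@bounded_integrable _ _ _ _ _ _ (c * `|v|)) => //; last exact: Fv.
  exact: borel_measurable_eval.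
by split=> // v; rewrite mulrAC; apply: normr_Rintegral_le => //; exact: Fv.
Qed.

(** Evaluations at points of [X] are among the functionals that test a Pettis integral in the
    dual. *)
Lemma is_pettis_integral_weak_star F A (y : topdual X) :
  is_pettis_integral mu A F y -> forall v, y v = \int[mu]_(t in A) F t v.
Proof. by move=> yP v; have [_ /(congr1 fine)] := yP (canonical_embedding v). Qed.

Lemma is_pettis_integral_unique F A (y z : topdual X) :
  is_pettis_integral mu A F y -> is_pettis_integral mu A F z -> y = z.
Proof.
move=> yP zP; apply: topdualP => v.
by rewrite (is_pettis_integral_weak_star yP) (is_pettis_integral_weak_star zP).
Qed.

End weak_star_integral.

Lemma canonical_embedding_continuous {R : realType} (X : normedModType R) :
  continuous (@canonical_embedding R X).
Proof.
move=> a; apply/cvgrPdist_le => e e0; apply/nbhs_ballP; exists e => //= b.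
rewrite -ball_normE /ball_/= => ab; rewrite (le_trans _ (ltW ab))//.
apply: topdual_ler_norm => // g.
rewrite topdualDE topdualNE -[X in `|X|]/(g a - g b) -linearB mulrC.
exact: ler_topdual.
Qed.

(** * The frame and its dual integrand *)

Section frame.
Context {d : measure_display} {M : measurableType d} {R : realType}.
Context (mu : {measure set M -> \bar R}) {X : completeNormedModType R}.
Context (x : M -> X) (f : M -> topdual X).
Context (hframe : continuous_schauder_frame mu x f).
Implicit Types (A E : set M) (g : topdual X).

(** Convertible to [canonical_embedding (x t) g *: f t], the integrand of the dual frame at [g]. *)
Definition dual_integrand g (t : M) : topdual X := g (x t) *: f t.

Lemma borel_measurable_frame_vector : borel_measurable x.
Proof.
apply: (@borel_measurable_comp _ _ _ _ _ _ fst) (csf_measurable hframe).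
by move=> p; exact: cvg_fst.
Qed.

Lemma borel_measurable_frame_functional : borel_measurable f.
Proof.
apply: (@borel_measurable_comp _ _ _ _ _ _ snd) (csf_measurable hframe).
by move=> p; exact: cvg_snd.
Qed.

(** Measurability is given for the pair of [x] and [f] in the product, so joint continuity of
    scaling suffices. *)
Lemma borel_measurable_dual_integrand g : borel_measurable (dual_integrand g).
Proof.
apply: (@borel_measurable_comp _ _ _ _ _ _
  (fun p : (X * topdual X)%type => g p.1 *: p.2)) (csf_measurable hframe).
move=> p; apply: cvgZ; last exact: cvg_snd.
by apply: (@cvg_comp _ _ _ fst g) (@topdual_continuous _ _ g _); exact: cvg_fst.
Qed.

Lemma borel_measurable_dual_frame :
  borel_measurable
    (fun t => (f t, canonical_embedding (x t)) : (topdual X * topdual (topdual X))%type).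
Proof.
apply: (@borel_measurable_comp _ _ _ _ _ _
  (fun p : (X * topdual X)%type => (p.2, canonical_embedding p.1)))
  (csf_measurable hframe).
move=> p.
have ec : canonical_embedding q.1 @[q --> p] --> canonical_embedding p.1.
  apply: (@continuous_comp _ _ _ fst (@canonical_embedding R X) p).
    exact: cvg_fst.
  exact: canonical_embedding_continuous.
apply: (@cvg_pair _ _ _ (nbhs p) (nbhs p.2) (nbhs (canonical_embedding p.1))) => //.
exact: cvg_snd.
Qed.

(** Since [g (f t v *: x t)] equals [g (x t) * f t v], a Pettis integral of the frame at [v], tested
    by [g], is a weak-star integral of the dual integrand at [v]. *)
Lemma frame_pettis_dual E v (y : X) :
  is_pettis_integral mu E (fun t => f t v *: x t) y -> forall g,
  mu.-integrable E (EFin \o (fun t => dual_integrand g t v)) /\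
  g y = \int[mu]_(t in E) dual_integrand g t v.
Proof.
move=> yP g; have := yP g.
have -> : (fun t => (g (f t v *: x t))%:E) =
    EFin \o (fun t => dual_integrand g t v).
  by apply/funext => t /=; rewrite linearZ/= mulrC.
by move=> [iE /(congr1 fine) yE].
Qed.

Lemma dual_integrand_integrable E g v : measurable E ->
  mu.-integrable E (EFin \o (fun t => dual_integrand g t v)).
Proof.
move=> mE; have [y yP] := csf_integrable hframe v mE.
by have [] := frame_pettis_dual yP g.
Qed.

Lemma frame_reconstruction g v :
  g v = \int[mu]_t dual_integrand g t v.
Proof.
rewrite {1}(csf_reconstruction hframe v).
have [y yP] := csf_integrable hframe v measurableT.
by have [] := frame_pettis_dual (xgetPex 0 (ex_intro _ y yP)) g.
Qed.

Lemma adjoint_tail_operator E g v : measurable E ->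
  adjoint (tail_operator mu x f E) g v =
  \int[mu]_(t in ~` E) dual_integrand g t v.
Proof.
move=> mE; have [y yP] := csf_integrable hframe v (measurableC mE).
by have [] := frame_pettis_dual (xgetPex 0 (ex_intro _ y yP)) g.
Qed.

Lemma dual_integral_scalar A g : measurable A ->
  scalar (fun v => \int[mu]_(t in A) dual_integrand g t v).
Proof.
move=> mA; apply: weak_star_integral_scalar => // v.
exact: dual_integrand_integrable.
Qed.

Lemma normr_dual_integrand g t : `|dual_integrand g t| <= `|g| * (`|f t| * `|x t|).
Proof.
by rewrite normrZ [X in _ <= _ * X]mulrC mulrA ler_wpM2r// ler_topdual.
Qed.

Definition bounded_exhausting (S : (set M)^nat) :=
  [/\ exhausting S, forall n, (mu (S n) < +oo)%E &
    forall n t, S n t -> `|x t| <= n%:R /\ `|f t| <= n%:R].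

(** A sigma-finite exhaustion is cut down by the sublevel sets of both norms; every point survives
    from some index on. *)
Lemma bounded_exhausting_ex : sigma_finite setT mu ->
  exists S, bounded_exhausting S.
Proof.
move=> /sigma_finiteP[F [FT ndF Ffin]].
have mx n : measurable [set t | `|x t| <= n%:R].
  have := borel_measurable_dist 0 borel_measurable_frame_vector.
  move=> /(_ measurableT _ (measurable_itv `]-oo, n%:R])).
  rewrite setTI; congr measurable; apply/seteqP.
  by split=> t /=; rewrite in_itv/= subr0.
have mf n : measurable [set t | `|f t| <= n%:R].
  have := borel_measurable_dist 0 borel_measurable_frame_functional.
  move=> /(_ measurableT _ (measurable_itv `]-oo, n%:R])).
  rewrite setTI; congr measurable; apply/seteqP.
  by split=> t /=; rewrite in_itv/= subr0.
exists (fun n => F n `&` ([set t | `|x t| <= n%:R] `&` [set t | `|f t| <= n%:R])).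
split; [split| |].
- by move=> n; apply: measurableI; [exact: (Ffin n).1|exact: measurableI].
- move=> m n mn; apply/subsetPset => t [Ft [/= xt ft]]; split.
    by have /subsetPset := ndF _ _ mn; exact.
  by split => /=; [rewrite (le_trans xt)|rewrite (le_trans ft)]; rewrite ?ler_nat.
- rewrite -subTset => t _.
  have : (\bigcup_i F i) t by rewrite -FT.
  move=> [i _ Ft].
  pose n := maxn i (maxn (Num.truncn `|x t|).+1 (Num.truncn `|f t|).+1).
  have i_n : (i <= n)%N by exact: leq_maxl.
  exists n => //; split; first by have /subsetPset := ndF _ _ i_n; exact.
  split => /=.
    by rewrite (le_trans (ltW (truncnS_gt _)))// ler_nat /n !leq_max leqnn !orbT.
  by rewrite (le_trans (ltW (truncnS_gt _)))// ler_nat /n !leq_max leqnn !orbT.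
- move=> n; rewrite (le_lt_trans _ (Ffin n).2)// le_measure ?inE//.
  + by apply: measurableI; [exact: (Ffin n).1|exact: measurableI].
  + exact: (Ffin n).1.
- by move=> n t [_ []].
Qed.

End frame.

(** * From shrinking to uniformly small tails *)

Section shrinking_frame.
Context {d : measure_display} {M : measurableType d} {R : realType}.
Context (mu : {measure set M -> \bar R}) {X : completeNormedModType R}.
Context (x : M -> X) (f : M -> topdual X) (S : (set M)^nat).
Context (hframe : continuous_schauder_frame mu x f).
Context (hS : bounded_exhausting mu x f S).
Implicit Types (A E : set M) (g : topdual X).

(** Phrased pointwise in [v], so that it makes sense before the weak-star integrals are known to be
    elements of [topdual X]. *)
Definition small_tails g := forall r, 0 < r -> exists n, forall A,
  measurable A -> A `&` S n = set0 -> forall v,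
  `|\int[mu]_(t in A) dual_integrand x f g t v| <= r * `|v|.

Lemma frame_domain_subset A n : measurable A -> A `<=` S n ->
  frame_domain mu x f A.
Proof.
have [[mS _ _] fS bS] := hS.
move=> mA AS; split=> //.
  by rewrite (le_lt_trans _ (fS n))// le_measure ?inE.
apply: (@le_lt_trans _ _ (n%:R * n%:R)%:E); last exact: ltry.
apply: ge_ereal_sup => _ [t At <-]; rewrite lee_fin.
by have [xt ft] := bS n t (AS t At); rewrite ler_pM.
Qed.

Lemma frame_domain_bound E : frame_domain mu x f E ->
  exists2 c, 0 <= c & forall t, E t -> `|f t| * `|x t| <= c.
Proof.
move=> [_ _]; set s := ereal_sup _ => soo.
have sb t : E t -> ((`|f t| * `|x t|)%:E <= s)%E.
  by move=> Et; apply: ereal_sup_ubound; exists t.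
(* The supremum [s] is [-oo] when [E] is empty; the absolute value keeps the witness nonnegative. *)
exists `|fine s| => // t Et; have := sb t Et.
case: s soo {sb} => [r _|//|//]; rewrite lee_fin => /le_trans; apply.
exact: ler_norm.
Qed.

Lemma shrinking_small_tails : shrinking mu x f -> forall g, small_tails g.
Proof.
have [exS fS bS] := hS; have [mS _ _] := exS.
move=> shr g r r0; have r4 : 0 < r / 4 by rewrite divr_gt0.
have /fine_cvgP[fin /cvgrPdist_le/(_ _ r4) near0] := shr g.
have [E0 DE0 E0P] := filterI fin near0.
have [mE0 fE0 _] := DE0.
have tailE E : frame_domain mu x f E -> E0 `<=` E -> forall v,
    `|\int[mu]_(t in ~` E) dual_integrand x f g t v| <= r / 4 * `|v|.
  move=> DE EE0 v; have [mE _ _] := DE.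
  have [/= finE] := E0P E (conj DE EE0); rewrite sub0r normrN => nE.
  have TE : adjoint (tail_operator mu x f E) g =
      fun u => \int[mu]_(t in ~` E) dual_integrand x f g t u.
    by apply/funext => u; exact: adjoint_tail_operator.
  rewrite TE in finE nE.
  apply: (@functional_norm_bound _ _
    (fun u => \int[mu]_(t in ~` E) dual_integrand x f g t u)).
    by apply: (dual_integral_scalar hframe); exact: measurableC.
  by rewrite -(fineK finE) lee_fin (le_trans (ler_norm _)).
(* Here [A] belongs to the directed set, so both [E0] and its union with [A] are past the threshold,
   and two tails of size [r / 4] are subtracted. *)
have disjS A m v : measurable A -> A `<=` S m -> A `&` E0 = set0 ->
    `|\int[mu]_(t in A) dual_integrand x f g t v| <= r / 2 * `|v|.
  move=> mA AS AE0.
  have DA := frame_domain_subset mA AS.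
  have mC : measurable (~` E0) by exact: measurableC.
  have := Rintegral_setD mA mC (dual_integrand_integrable hframe g v mC).
  have -> : ~` E0 `&` A = A.
    apply/seteqP; split=> t /=; first by case.
    move=> At; split=> // E0t.
    by have : (A `&` E0) t by []; rewrite AE0.
  have -> : ~` E0 `\` A = ~` (E0 `|` A) by rewrite setCU.
  have /ler_normlP[h1 h2] := tailE _ (frame_domainU DE0 DA) (@subsetUl _ _ _) v.
  have /ler_normlP[h3 h4] := tailE _ DE0 (@subset_refl _ _) v.
  by move=> h; apply/ler_normlP; split; lra.
have disj A v : measurable A -> A `&` E0 = set0 ->
    `|\int[mu]_(t in A) dual_integrand x f g t v| <= r / 2 * `|v|.
  move=> mA AE0; apply: (@le_forall_addM _ _ _ 1) => e e0; rewrite mul1r.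
  have iA := dual_integrand_integrable hframe g v mA.
  have [m mP] := exhausting_small_tail exS mA iA e0.
  rewrite (Rintegral_setD (mS m))// (le_trans (ler_normD _ _))// lerD//.
    apply: (@disjS _ m) => //; first exact: measurableI.
    by rewrite setIAC AE0 set0I.
  by apply: (mP m) => //; [exact: measurableD|rewrite setDE -setIA setICl setI0].
have [c c0 cE0] := frame_domain_bound DE0.
have gc0 : 0 < `|g| * c + 1 by rewrite ltr_wpDl// mulr_ge0.
(* With the constant function 1, the small-tail lemma says that the measure of [E0] outside [S n]
   tends to 0. *)
have i1 : mu.-integrable E0 (EFin \o (fun=> 1 : R)).
  by apply: (@bounded_integrable _ _ _ _ _ _ 1) => // t _; rewrite normr1.
(* Measure below this threshold times the bound [|g| * c] on the integrand gives at most [r / 2];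
   the added 1 avoids a zero denominator. *)
have d0 : 0 < r / 2 / (`|g| * c + 1) by rewrite !divr_gt0.
have [n nP] := exhausting_small_tail exS mE0 i1 d0.
exists n => A mA AS v.
have iA := dual_integrand_integrable hframe g v mA.
rewrite (Rintegral_setD mE0)// (le_trans (ler_normD _ _))//.
rewrite [r]splitr mulrDl lerD//; last first.
  by apply: disj; [exact: measurableD|rewrite setDE -setIA setICl setI0].
have mAE : measurable (A `&` E0) by exact: measurableI.
have fAE : (mu (A `&` E0) < +oo)%E.
  by rewrite (le_lt_trans _ fE0)// le_measure ?inE//; exact: subIsetr.
have [_ /(_ v) b] := weak_star_integral_bounded (c := `|g| * c)
  (borel_measurable_dual_integrand hframe g) mAE fAE
  (fun t At => le_trans (normr_dual_integrand x f g t)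
     (ler_wpM2l (normr_ge0 g) (cE0 t At.2))).
rewrite (le_trans b)// ler_wpM2r//.
have := nP n _ (leqnn n) mAE (@subIsetr _ _ _).
rewrite Rintegral_cst// mul1r ger0_norm ?fine_ge0// setIAC AS set0I => /(_ erefl).
rewrite ler_pdivlMr// => h; rewrite (le_trans _ h)// mulrC ler_wpM2l ?fine_ge0//.
by rewrite lerDl.
Qed.

(** On [S n] the integrand is bounded and the measure finite; outside [S n] the tail is at most 1.
    Both bounds are independent of [A]. *)
Lemma small_tails_bounded g : small_tails g -> exists2 c, 0 <= c &
  forall A, measurable A -> forall v,
  `|\int[mu]_(t in A) dual_integrand x f g t v| <= c * `|v|.
Proof.
have [[mS _ _] fS bS] := hS.
move=> /(_ 1 ltr01)[n nP].
exists (`|g| * (n%:R * n%:R) * fine (mu (S n)) + 1).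
  by rewrite addr_ge0// !mulr_ge0// fine_ge0.
move=> A mA v; have iA := dual_integrand_integrable hframe g v mA.
rewrite (Rintegral_setD (mS n))// (le_trans (ler_normD _ _))// mulrDl lerD//.
  have mAS : measurable (A `&` S n) by exact: measurableI.
  have fAS : (mu (A `&` S n) < +oo)%E.
    by rewrite (le_lt_trans _ (fS n))// le_measure ?inE//; exact: subIsetr.
  have bA t : (A `&` S n) t -> `|dual_integrand x f g t| <= `|g| * (n%:R * n%:R).
    move=> [_ /bS[xt ft]]; rewrite (le_trans (normr_dual_integrand _ _ _ _))//.
    by rewrite ler_wpM2l// ler_pM.
  have [_ /(_ v) b] := weak_star_integral_bounded
    (borel_measurable_dual_integrand hframe g) mAS fAS bA.
  rewrite (le_trans b)// ler_wpM2r// ler_wpM2l ?mulr_ge0//.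
  by rewrite fine_le_measure//; exact: subIsetr.
by apply: nP; [exact: measurableD|rewrite setDE -setIA setICl setI0].
Qed.

End shrinking_frame.

(** * The dual frame and the two implications *)

Section dual_frame.
Context {d : measure_display} {M : measurableType d} {R : realType}.
Context (mu : {measure set M -> \bar R}) {X : completeNormedModType R}.
Context (x : M -> X) (f : M -> topdual X) (S : (set M)^nat).
Context (hframe : continuous_schauder_frame mu x f).
Context (hS : bounded_exhausting mu x f S).
Implicit Types (A E : set M) (g : topdual X).

(* The countable family with dense span consists of the integrals of [f] over
   the pieces of [S n] on which [x] is nearly constant. *)
Lemma small_tails_separable :
  (forall g, small_tails mu x f S g) -> separable (topdual X).
Proof.
have [[mS _ _] fS bS] := hS.
have mx := borel_measurable_frame_vector hframe.
have mf := borel_measurable_frame_functional hframe.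
move=> tails; have [h hd] := separable_seq (csf_separable hframe).
pose B k j : set M := [set t | `|x t - h j| <= k.+1%:R^-1].
pose P n k j := peel (S n) (B k) j `&` B k j.
have k0 k : 0 < k.+1%:R^-1 :> R by rewrite invr_gt0.
have mB k j : measurable (B k j).
  by have [+ _] := peel_approx mx hd (mS 0%N) (fS 0%N) (k0 k); exact.
have PS n k j : P n k j `<=` S n by move=> t [/peel_sub].
have mP n k j : measurable (P n k j).
  exact: (measurableI _ _ (measurable_peel j (mS n) (mB k)) (mB k j)).
have fP n k j : (mu (P n k j) < +oo)%E.
  by rewrite (le_lt_trans _ (fS n))// le_measure ?inE//; exact: PS.
have fb n k j t : P n k j t -> `|f t| <= n%:R by move=> /PS/bS[].
have iP n k j v : mu.-integrable (P n k j) (EFin \o (fun t => f t v)).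
  by have [] := weak_star_integral_bounded mf (mP n k j) (fP n k j) (@fb n k j).
have eex (i : nat * nat * nat) : exists y : topdual X, forall v,
    y v = \int[mu]_(t in P i.1.1 i.1.2 i.2) f t v.
  have [iF bF] := weak_star_integral_bounded mf (mP i.1.1 i.1.2 i.2)
    (fP i.1.1 i.1.2 i.2) (@fb i.1.1 i.1.2 i.2).
  exact: weak_star_integral_ex bF.
have [e eE] := choice eex.
apply: (@separable_span _ _ _ e) => g r r0.
have r2 : 0 < r / 2 by rewrite divr_gt0.
have [n nP] := tails g _ r2.
(* The total error on [S n] is [c / k.+1] times [|v|]: the summand with [fine (mu (S n))] comes from
   replacing [x t] by [h j], the one with [n%:R] from the unpeeled remainder. *)
pose c : R := `|g| * n%:R * (fine (mu (S n)) + n%:R).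
have c0 : 0 <= c by rewrite !mulr_ge0// addr_ge0// fine_ge0.
have rc : 0 < r / 2 / (c + 1) by rewrite divr_gt0// ltr_wpDl.
have [k _ /(_ k (leqnn k)) kr] := near_infty_natSinv_lt (PosNum rc).
have {kr} kr : k.+1%:R^-1 * c <= r / 2.
  rewrite (@le_trans _ _ (r / 2 / (c + 1) * (c + 1)))//; last first.
    by rewrite divfK// gt_eqF// ltr_wpDl.
  by rewrite ler_pM ?(ltW kr)// ?lerDl// ltW.
have [_ [J JP]] := peel_approx mx hd (mS n) (fS n) (k0 k).
(* On the piece with index [j] the coefficient [g (x t)] is frozen at [g (h j)]. *)
exists [seq (g (h j), (n, k, j)) | j <- index_iota 0 J].
rewrite big_map big_mkord /=.
set z := \sum_(j < J) _.
apply: topdual_ler_norm => [|v]; first exact: ltW.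
rewrite topdualDE topdualNE.
have -> : z v = \sum_(j < J) \int[mu]_(t in P n k j) (g (h j) * f t v).
  rewrite -[LHS]/(canonical_embedding v z) linear_sum; apply: eq_bigr => j _.
  by rewrite RintegralZl// -[LHS]/(g (h j) * e (n, k, nat_of_ord j) v) eE.
rewrite (frame_reconstruction hframe) (Rintegral_setD (mS n))//; last first.
  exact: (dual_integrand_integrable hframe).
rewrite setTI setTD addrAC (le_trans (ler_normD _ _))// (splitr r) mulrDl lerD//.
  rewrite (le_trans (@Rintegral_peel _ _ _ mu (S n) (B k) _
    (fun j t => g (h j) * f t v) (`|g| * k.+1%:R^-1 * (n%:R * `|v|))
    (`|g| * n%:R * (n%:R * `|v|)) J _ (mS n) (fS n) (mB k) _ _ _ _))//.
  - exact: (dual_integrand_integrable hframe).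
  - by move=> j; exact: (integrableZl _ (g (h j)) (iP n k j v)).
  - move=> j t Pt; rewrite topdualZE -mulrBl normrM -linearB.
    rewrite ler_pM//; last first.
      by rewrite (le_trans (ler_topdual _ _))// ler_wpM2r// (fb _ _ _ _ Pt).
    by rewrite (le_trans (ler_topdual _ _))// ler_wpM2l//; case: Pt.
  - move=> t /bS[xt ft]; rewrite topdualZE normrM ler_pM//.
      by rewrite (le_trans (ler_topdual _ _))// ler_wpM2l.
    by rewrite (le_trans (ler_topdual _ _))// ler_wpM2r.
  - rewrite (@le_trans _ _ (k.+1%:R^-1 * c * `|v|))// ?ler_wpM2r//.
    have : `|g| * n%:R * (n%:R * `|v|) * fine (mu (peel (S n) (B k) J)) <=
      `|g| * n%:R * (n%:R * `|v|) * k.+1%:R^-1.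
      by rewrite ler_wpM2l// !mulr_ge0.
    move=> /(lerD (lexx _))/le_trans; apply; rewrite /c.
    by move: (k.+1%:R^-1) (fine _) => q m; lra.
by apply: nP; [exact: measurableC|rewrite setICl].
Qed.

(** Inside [S n] each [phi] commutes with the integral, since the integrand is bounded there. The
    uniform bound on [y] then makes [phi] integrable along [F], and the identity passes to [E]
    because the tails on both sides are small. *)
Lemma small_tails_pettis g : separable (topdual X) -> small_tails mu x f S g ->
  forall E, measurable E -> exists y : topdual X,
    is_pettis_integral mu E (dual_integrand x f g) y.
Proof.
have [exS fS bS] := hS; have [mS ndS _] := exS.
move=> sepX tails; set F := dual_integrand x f g.
have mF : borel_measurable F := borel_measurable_dual_integrand hframe g.
have iF A v : measurable A -> mu.-integrable A (EFin \o (fun t => F t v)).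
  exact: dual_integrand_integrable.
have [c c0 cF] := small_tails_bounded hframe hS tails.
have yex A : exists y : topdual X, measurable A -> forall v,
    y v = \int[mu]_(t in A) F t v.
  have [mA|] := pselect (measurable A); last by exists 0.
  have [y yE] := weak_star_integral_ex mA (fun v => iF A v mA) (cF A mA).
  by exists y.
have [y yE] := choice yex.
have yc A : measurable A -> `|y A| <= c.
  by move=> mA; apply: topdual_ler_norm => // v; rewrite yE//; exact: cF.
have Fb n t : S n t -> `|F t| <= `|g| * (n%:R * n%:R).
  move=> /bS[xt ft]; rewrite (le_trans (normr_dual_integrand _ _ _ _))//.
  by rewrite ler_wpM2l// ler_pM.
move=> E mE; exists (y E) => phi.
have mphi : measurable_fun setT (fun t => phi (F t)).
  exact: borel_measurable_functional.
have fsub A n : measurable A -> A `<=` S n -> (mu A < +oo)%E.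
  by move=> mA AS; rewrite (le_lt_trans _ (fS n))// le_measure ?inE.
have phiE A n : measurable A -> A `<=` S n ->
    phi (y A) = \int[mu]_(t in A) phi (F t).
  move=> mA AS; apply: (weak_star_integral_functional (c := `|g| * (n%:R * n%:R))) => //.
  - exact: fsub AS.
  - by move=> t /AS; exact: Fb.
  - exact: yE.
have iphi n : mu.-integrable (S n) (EFin \o (fun t => phi (F t))).
  apply: (@bounded_integrable _ _ _ _ _ _ (`|phi| * (`|g| * (n%:R * n%:R)))) => //.
  by move=> t St; rewrite (le_trans (ler_topdual _ _))// ler_wpM2l// Fb.
have iphiT : mu.-integrable setT (EFin \o (fun t => phi (F t))).
  apply: (exhausting_integrable (c := `|phi| * c + `|phi| * c) exS) => // n.
  (* Splitting by the sign of [phi (F t)] turns the integral of the absolute value into two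
     integrals equal to [phi (y A)] up to sign, each at most [|phi| * c]. *)
  pose P := [set t | 0 <= phi (F t)].
  have mP : measurable P.
    rewrite -[P]setTI.
    have -> : P = (fun t => phi (F t)) @^-1` `[0, +oo[.
      by apply/seteqP; split=> t /=; rewrite in_itv/= andbT.
    by apply: mphi => //; exact: measurable_itv.
  have mSP : measurable (S n `&` P) by exact: measurableI.
  have mSD : measurable (S n `\` P) by exact: measurableD.
  have ab A : measurable A -> A `<=` S n ->
      `|\int[mu]_(t in A) phi (F t)| <= `|phi| * c.
    move=> mA AS; rewrite -(phiE A n)// (le_trans (ler_topdual _ _))//.
    by rewrite ler_wpM2l// yc.
  rewrite (Rintegral_setD mP)//; last exact: integrable_norm.
  rewrite lerD//.
    have -> : \int[mu]_(t in S n `&` P) `|phi (F t)| =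
        \int[mu]_(t in S n `&` P) phi (F t).
      by apply: eq_Rintegral => t /set_mem[_ Pt]; rewrite ger0_norm.
    by rewrite (le_trans (ler_norm _))// ab//; exact: subIsetl.
  have -> : \int[mu]_(t in S n `\` P) `|phi (F t)| =
      \int[mu]_(t in S n `\` P) (-1 * phi (F t)).
    apply: eq_Rintegral => t /set_mem[_ /negP].
    by rewrite -ltNge mulN1r => /ltr0_norm.
  rewrite RintegralZl//; last by apply: integrableS (iphi n).
  by rewrite mulN1r (le_trans (ler_norm _))// normrN ab.
have iphiE : mu.-integrable E (EFin \o (fun t => phi (F t))).
  exact: integrableS iphiT.
split=> //; rewrite -[RHS]fineK; last exact: integrable_fin_num.
congr EFin; apply/eqP; rewrite -subr_eq0 -normr_le0.
apply: (@le_forall_addM _ _ _ (`|phi| + 1)) => r r0.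
have [n1 n1P] := exhausting_small_tail exS mE iphiE r0.
have [n2 n2P] := tails _ r0.
(* Past both thresholds: [n1] for the scalar integral of [phi] along [F], [n2] for the norm of
   [y]. *)
pose n := maxn n1 n2.
have mES : measurable (E `&` S n) by exact: measurableI.
have mED : measurable (E `\` S n) by exact: measurableD.
have ES0 m : (m <= n)%N -> (E `\` S n) `&` S m = set0.
  move=> mn; rewrite -subset0 => t [[_ nSt] St]; apply: nSt.
  by have /subsetPset := ndS _ _ mn; exact.
have -> : y E = y (E `&` S n) + y (E `\` S n).
  apply: topdualP => v; rewrite topdualDE !yE//.
  by apply: Rintegral_setD => //; exact: iF.
rewrite -[fine _]/(\int[mu]_(t in E) phi (F t)) (Rintegral_setD (mS n))//.
rewrite linearD/= (phiE (E `&` S n) n)//.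
rewrite opprD addrACA subrr !add0r mulrDl mul1r (le_trans (ler_normB _ _))// lerD//.
  rewrite (le_trans (ler_topdual _ _))// ler_wpM2l// topdual_ler_norm ?(ltW r0)// => v.
  by rewrite yE//; apply: n2P => //; apply: ES0; exact: leq_maxr.
by apply: (n1P n); rewrite ?leq_maxl//; exact: ES0.
Qed.

Lemma shrinking_dual_frame : shrinking mu x f ->
  continuous_schauder_frame mu f (fun t => canonical_embedding (x t)).
Proof.
move=> /(shrinking_small_tails hframe hS) tails.
have sepX := small_tails_separable tails.
split=> //.
- exact: (borel_measurable_dual_frame hframe).
- by move=> g E mE; exact: small_tails_pettis.
move=> g; have [y yP] := small_tails_pettis sepX (tails g) measurableT.
have gy : g = y.
  apply: topdualP => v; rewrite (is_pettis_integral_weak_star yP).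
  exact: frame_reconstruction.
rewrite [LHS]gy; apply: (is_pettis_integral_unique yP).
by have := xgetPex 0 (ex_intro _ y yP).
Qed.

(** A frame for the dual includes separability of the dual, and its Pettis integrals are weak-star
    integrals defined for all measurable sets; these are the inputs of the Orlicz-Pettis step. *)
Lemma dual_frame_shrinking :
  continuous_schauder_frame mu f (fun t => canonical_embedding (x t)) ->
  shrinking mu x f.
Proof.
have [exS fS bS] := hS; have [mS ndS _] := exS.
move=> hdual g.
have yex A : exists y : topdual X, measurable A -> forall v,
    y v = \int[mu]_(t in A) dual_integrand x f g t v.
  have [mA|] := pselect (measurable A); last by exists 0.
  have [y yP] := csf_integrable hdual g mA.
  by exists y => _; exact: is_pettis_integral_weak_star yP.
have [y yE] := choice yex.
have normE (r : R) : 0 < r -> exists n, forall E, frame_domain mu x f E ->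
    S n `<=` E ->
    (functional_norm (adjoint (tail_operator mu x f E) g) <= r%:E)%E.
  move=> r0.
  have [n nP] := weak_star_integral_small_tail (csf_separable hdual) exS
    (fun v => dual_integrand_integrable hframe g v measurableT) yE r0.
  exists n => E [mE _ _] SE; apply: functional_norm_le => [|v]; first exact: ltW.
  have mC : measurable (~` E) by exact: measurableC.
  rewrite (adjoint_tail_operator hframe)// -yE//.
  rewrite (le_trans (ler_topdual _ _))// ler_wpM2r// nP//.
  by rewrite -subset0 => t [nE /SE].
(* Each [S n] is itself in the directed set, so a property of all members containing it holds
   eventually along the net. *)
have netE n (Q : set (set M)) : (forall E, frame_domain mu x f E ->
    S n `<=` E -> Q E) -> \forall E \near frame_net mu x f, Q E.
  move=> QE; exists (S n); first exact: (frame_domain_subset hS (mS n) (@subset_refl _ _)).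
  by move=> E [DE SE]; exact: QE.
(* Convergence in the extended reals splits into eventual finiteness, where the bound 1 suffices,
   and convergence of the real values. *)
apply/fine_cvgP; split.
  have [n nP] := normE 1 ltr01; apply: (netE n) => E DE SE.
  rewrite ge0_fin_numE ?functional_norm_ge0//.
  exact: le_lt_trans (nP E DE SE) (ltry _).
apply/cvgrPdist_le => r r0; have [n nP] := normE r r0.
apply: (netE n) => E DE SE /=; rewrite sub0r normrN.
have n0 := functional_norm_ge0 (adjoint (tail_operator mu x f E) g).
rewrite ger0_norm ?fine_ge0// -lee_fin fineK ?nP//.
by rewrite ge0_fin_numE// (le_lt_trans (nP E DE SE)) ?ltry.
Qed.

End dual_frame.

Theorem theorem3p4 (R : realType) (d : measure_display) (M : measurableType d)
    (mu : {sigma_finite_measure set M -> \bar R})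
    (X : completeNormedModType R) (x : M -> X) (f : M -> topdual X)
    (hframe : continuous_schauder_frame mu x f) :
  shrinking mu x f <->
  continuous_schauder_frame mu f (fun t => canonical_embedding (x t)).
Proof.
have [S hS] := bounded_exhausting_ex hframe (sigma_finiteT mu).
split; first exact: (shrinking_dual_frame hframe hS).
exact: (dual_frame_shrinking hframe hS).
Qed.
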